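(* Let $I$ be a set. Every $I$-dimensional cylindric Boolean algebra $A$ is isomorphic (as an $I$-dimensional cylindric Boolean algebra) to $\mathcal{G}_0(\mathcal{F}_0(A))$. Moreover, every $I$-dimensional cylindric UV-space $X$ is relationally homeomorphic to $\mathcal{F}_0(\mathcal{G}_0(X))$.
   Context: A quantifier on a Boolean algebra $A$ (complement written $a^{\perp}$) is a map $\exists\colon A\to A$ with $\exists(a\vee b)=\exists a\vee\exists b$, $\exists0=0$, $\exists\exists a=\exists a$, $a\le\exists a$, $\exists(\exists a)^{\perp}=(\exists a)^{\perp}$. An $I$-dimensional cylindric Boolean algebra is a Boolean algebra $A$ with unary operators $(\exists_i)_{i\in I}$ and constants $(\delta_{i,k})_{i,k\in I}$ such that for all $i,k,l\in I$ and $a\in A$: (1) $\exists_i$ is a quantifier; (2) $\exists_i\exists_ka=\exists_k\exists_ia$; (3) $\delta_{i,k}=\delta_{k,i}$, $\delta_{i,i}=1$; (4) if $k\neq i$ and $k\ne l$, then $\delta_{i,l}=\exists_k(\delta_{i,k}\wedge\delta_{k,l})$; (5) if $i\ne k$, then $\exists_i(\delta_{i,k}\wedge a)\wedge\exists_i(\delta_{i,k}\wedge a^{\perp})=0$. For a $T_0$-space $X$ with specialization order $\leqslant$ ($x\leqslant y$ iff every open set containing $x$ contains $y$), let $\text{Int}_{\leqslant}(U)=\{x:y\in U\text{ for all }y\geqslant x\}$, $\text{Cl}_{\leqslant}(U)=\{x:y\in U\text{ for some }y\geqslant x\}$, $U^*=\text{Int}_{\leqslant}(X\setminus U)$. $\mathcal{REG}(X)$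 is the set of regular open subsets of the upset topology of $(X,\leqslant)$, i.e. upsets $U$ with $\text{Int}_{\leqslant}(\text{Cl}_{\leqslant}(U))=U$, equivalently $U^{**}=U$. $\mathcal{CO}(X)$ is the set of compact open subsets of $X$, $\mathcal{COREG}(X)=\mathcal{CO}(X)\cap\mathcal{REG}(X)$, $\mathcal{COREG}_X(x)=\{U\in\mathcal{COREG}(X):x\in U\}$. A UV-space is a $T_0$-space $X$ such that $\mathcal{COREG}(X)$ is closed under $\cap$ and $\text{Int}_{\leqslant}(X\setminus\cdot)$ and is a basis for $X$, and every proper filter in $\mathcal{COREG}(X)$ is $\mathcal{COREG}_X(x)$ for some $x\in X$ (filters are non-empty). For a relation $S$, $S[U]=\{y:xSy\text{ for some }x\in U\}$, and $\exists_SU=S[U]$; $\exists_S[\mathcal{COREG}_X(x)]=\{\exists_SU:U\in\mathcal{COREG}_X(x)\}$. An $I$-dimensional cylindric UV-space is $\langle X;(S_i)_{i\in I},(\Delta_{i,k})_{i,k\in I},\tau\rangle$ such that for all $i,k,l\in I$: (1) $\langle X;\tau\rangle$ is a UV-space; (2) $S_i$ is an equivalence relation; (3) $S_i\circ S_k=S_k\circ S_i$; (4) $\Delta_{i,k}\subseteq X$, $\Delta_{i,k}^{**}=\Delta_{i,k}=\Delta_{k,i}$, $\Delta_{i,i}=X$; (5) if $i\neq k$ and $l\ne k$, $S_k[\Delta_{i,k}\cap\Delta_{k,l}]=\Delta_{i,l}$; (6) if $i\ne k$, then $S_i[\Delta_{i,k}\cap U]\cap S_i[\Delta_{i,k}\cap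 U^*]=\emptyset$ for all $U\in\mathcal{COREG}(X)$; (7) $S_i[U]\in\mathcal{COREG}(X)$ for $U\in\mathcal{COREG}(X)$; (8) if not $xS_iy$, then $\exists_{S_i}[\mathcal{COREG}_X(x)]\ne\exists_{S_i}[\mathcal{COREG}_X(y)]$; (9) $\Delta_{i,k}\in\mathcal{CO}(X)$. $\mathcal{G}_0(X)=\langle\mathcal{COREG}(X);\cap,\sqcup,{}^*,\emptyset,X,(\exists_{S_i})_{i\in I},(\Delta_{i,k})_{i,k\in I}\rangle$ with $U\sqcup V=\text{Int}_{\leqslant}(\text{Cl}_{\leqslant}(U\cup V))$. $\mathcal{F}_0(A)=\langle\mathfrak{F}(A);(S_i)_{i\in I},(\Delta_{i,k})_{i,k\in I},\tau(\beta)\rangle$, where $\mathfrak{F}(A)$ is the set of non-empty proper filters of $A$; $xS_iy$ iff $\{\exists_ia:a\in x\}=\{\exists_ia:a\in y\}$; $\Delta_{i,k}=\phi(\delta_{i,k})$; and $\tau(\beta)$ is the topology with basis $\{\phi(a):a\in A\}$, $\phi(a)=\{x\in\mathfrak{F}(A):a\in x\}$. A relational homeomorphism is a homeomorphism $f$ with $xS_iy\Leftrightarrow f(x)S_if(y)$ for all $i\in I$ and all $x,y$. *)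

(* Defs.v *)
From HB Require Import structures.
From mathcomp Require Import all_boot all_order.
From mathcomp Require Import all_classical topology.

Set Implicit Arguments.
Unset Strict Implicit.
Unset Printing Implicit Defensive.

Import Order.Theory.
Local Open Scope classical_set_scope.

Record is_quantifier d (A : ctbDistrLatticeType d) (e : A -> A) : Prop := {
  quantifierU : forall a b, e (a `|` b)%O = (e a `|` e b)%O;
  quantifier0 : e \bot%O = \bot%O;
  quantifierK : forall a, e (e a) = e a;
  quantifier_ge : forall a, (a <= e a)%O;
  quantifierC : forall a, e (~` (e a))%O = (~` (e a))%O }.

Record cylindricBA (I : Type) := CylindricBA {
  cba_disp : Order.disp_t;
  cba_sort :> ctbDistrLatticeType cba_disp;
  cba_ex : I -> cba_sort -> cba_sort;
  cba_delta : I -> I -> cba_sort;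
  cba_quantifier : forall i, is_quantifier (cba_ex i);
  cba_exC : forall i k a, cba_ex i (cba_ex k a) = cba_ex k (cba_ex i a);
  cba_deltaC : forall i k, cba_delta i k = cba_delta k i;
  cba_delta_refl : forall i, cba_delta i i = \top%O;
  cba_delta_trans : forall i k l, k <> i -> k <> l ->
    cba_delta i l = cba_ex k (cba_delta i k `&` cba_delta k l)%O;
  cba_delta_sub : forall i k a, i <> k ->
    (cba_ex i (cba_delta i k `&` a) `&`
     cba_ex i (cba_delta i k `&` ~` a) = \bot)%O }.

Arguments cba_ex {I c} _ _.
Arguments cba_delta {I c} _ _.

Definition cba_isomorphic I (A B : cylindricBA I) : Prop :=
  exists f : A -> B,
    bijective f /\
    {morph f : a b / (a `&` b)%O} /\
    {morph f : a b / (a `|` b)%O} /\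
    {morph f : a / (~` a)%O} /\
    f \bot%O = \bot%O /\
    f \top%O = \top%O /\
    (forall i, {morph f : a / cba_ex i a}) /\
    (forall i k, f (cba_delta i k) = cba_delta i k).

Definition rel_image T (S : T -> T -> Prop) (U : set T) : set T :=
  [set y | exists2 x, U x & S x y].

Definition rel_comp T (S R : T -> T -> Prop) : T -> T -> Prop :=
  fun x z => exists2 y, S x y & R y z.

Section UpsetTopology.
Context {X : topologicalType}.
Implicit Types (x y : X) (U V : set X).

Definition spec_le x y : Prop := forall U, open U -> U x -> U y.

Definition spec_upset U : Prop := forall x y, spec_le x y -> U x -> U y.

Definition spec_int U : set X := [set x | forall y, spec_le x y -> U y].

Definition spec_cl U : set X := [set x | exists2 y, spec_le x y & U y].

Definition spec_star U : set X := spec_int (~` U).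

Definition REG : set (set X) :=
  [set U | spec_upset U /\ spec_int (spec_cl U) = U].

Definition CO : set (set X) := [set U | compact U /\ open U].

Definition COREG : set (set X) := CO `&` REG.

Definition COREG_at x : set (set X) := [set U | COREG U /\ U x].

Record coreg_proper_filter (F : set (set X)) : Prop := {
  cpf_sub : F `<=` COREG;
  cpf_nonempty : F !=set0;
  cpf_meet : forall U V, F U -> F V -> F (U `&` V);
  cpf_up : forall U V, F U -> COREG V -> U `<=` V -> F V;
  cpf_proper : F <> COREG }.

End UpsetTopology.

Arguments REG : clear implicits.
Arguments CO : clear implicits.
Arguments COREG : clear implicits.

Record is_UV (X : topologicalType) : Prop := {
  uv_T0 : kolmogorov_space X;
  uv_COREGI : forall U V, COREG X U -> COREG X V -> COREG X (U `&` V);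
  uv_COREGC : forall U, COREG X U -> COREG X (spec_int (~` U));
  uv_basis : basis (COREG X);
  uv_filter : forall F, coreg_proper_filter F -> exists x : X, F = COREG_at x }.

Record uvSpace := UVSpace {
  uv_sort :> topologicalType;
  uvP : is_UV uv_sort }.

Record cylindricUV (I : Type) := CylindricUV {
  cuv_sort :> uvSpace;
  cuv_rel : I -> cuv_sort -> cuv_sort -> Prop;
  cuv_diag : I -> I -> set cuv_sort;
  cuv_equiv : forall i, RelationClasses.Equivalence (cuv_rel i);
  cuv_relC : forall i k,
    rel_comp (cuv_rel i) (cuv_rel k) = rel_comp (cuv_rel k) (cuv_rel i);
  cuv_diagK : forall i k, spec_star (spec_star (cuv_diag i k)) = cuv_diag i k;
  cuv_diagC : forall i k, cuv_diag i k = cuv_diag k i;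
  cuv_diag_refl : forall i, cuv_diag i i = setT;
  cuv_diag_trans : forall i k l, i <> k -> l <> k ->
    rel_image (cuv_rel k) (cuv_diag i k `&` cuv_diag k l) = cuv_diag i l;
  cuv_diag_sub : forall i k, i <> k -> forall U, COREG cuv_sort U ->
    rel_image (cuv_rel i) (cuv_diag i k `&` U) `&`
    rel_image (cuv_rel i) (cuv_diag i k `&` spec_star U) = set0;
  cuv_image : forall i U, COREG cuv_sort U ->
    COREG cuv_sort (rel_image (cuv_rel i) U);
  cuv_sep : forall i x y, ~ cuv_rel i x y ->
    rel_image (cuv_rel i) @` COREG_at x <> rel_image (cuv_rel i) @` COREG_at y;
  cuv_diag_CO : forall i k, CO cuv_sort (cuv_diag i k) }.

Arguments cuv_rel {I c} _ _ _.
Arguments cuv_diag {I c} _ _.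

(* The relations S_i have to be preserved and reflected; nothing is required of
   the diagonals Delta_(i,k). *)
Definition relationally_homeomorphic I (X Y : cylindricUV I) : Prop :=
  exists (f : X -> Y) (g : Y -> X),
    cancel f g /\ cancel g f /\ continuous f /\ continuous g /\
    (forall i x y, cuv_rel i x y <-> cuv_rel i (f x) (f y)).

Section UpsetTheory.
Context {X : topologicalType}.
Implicit Types (x y z : X) (U V W : set X).

Lemma spec_le_refl x : spec_le x x. Proof. by []. Qed.

Lemma spec_le_trans y x z : spec_le x y -> spec_le y z -> spec_le x z.
Proof. by move=> xy yz U oU Ux; apply: yz => //; apply: xy. Qed.

Lemma spec_starK U : spec_star (spec_star U) = spec_int (spec_cl U).
Proof.
apply/seteqP; split=> x xU y xy.
  by apply: contrapT => nU; apply: (xU y xy) => z yz Uz; apply: nU; exists z.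
by move=> yU; have [z yz Uz] := xU y xy; apply: (yU z yz).
Qed.

Lemma spec_starU U V : spec_star (U `|` V) = spec_star U `&` spec_star V.
Proof.
apply/seteqP; split=> [x xUV|x [xU xV] y xy [|]]; [|exact: xU|exact: xV].
by split=> y xy ?; apply: (xUV y xy); [left|right].
Qed.

Lemma spec_int_sub U : spec_int U `<=` U.
Proof. by move=> x; apply; exact: spec_le_refl. Qed.

Lemma open_upset U : open U -> spec_upset U.
Proof. by move=> oU x y xy; apply: xy. Qed.

Lemma COREG_open U : COREG X U -> open U. Proof. by case=> -[]. Qed.

Lemma COREG_upset U : COREG X U -> spec_upset U. Proof. by case=> _ []. Qed.

Lemma COREG_regular U : COREG X U -> spec_star (spec_star U) = U.
Proof. by rewrite spec_starK => -[_ []]. Qed.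

Lemma COREG0 : COREG X set0.
Proof.
split; first by split; [exact: compact0|exact: open0].
split=> //; apply/seteqP; split=> // x /(_ x (@spec_le_refl x)).
by move=> -[].
Qed.

End UpsetTheory.

Section CoregAlgebra.
Variable X : uvSpace.

Definition coreg_alg := set_type (COREG X).

HB.instance Definition _ := Choice.on coreg_alg.

Implicit Types (U V W : coreg_alg).

Lemma coregP U : COREG X (val U).
Proof. exact: set_valP. Qed.

Definition coreg_mk (U : set X) (hU : COREG X U) : coreg_alg :=
  exist _ U (mem_set hU).

Lemma COREG_joinP U V :
  COREG X (spec_int (spec_cl (val U `|` val V))).
Proof.
rewrite -spec_starK spec_starU; have uv := uvP X.
by apply: (uv_COREGC uv); apply: (uv_COREGI uv); apply: (uv_COREGC uv);
  apply: coregP.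
Qed.

Lemma COREG_T : COREG X setT.
Proof.
rewrite (_ : setT = spec_int (~` set0)); first exact/(uv_COREGC (uvP X))/COREG0.
by apply/seteqP; split=> // x _ y _ [].
Qed.

Definition coreg_meet U V : coreg_alg :=
  coreg_mk (uv_COREGI (uvP X) (coregP U) (coregP V)).
Definition coreg_join U V : coreg_alg := coreg_mk (COREG_joinP U V).
Definition coreg_compl U : coreg_alg :=
  @coreg_mk (spec_star (val U)) (uv_COREGC (uvP X) (coregP U)).
Definition coreg_bot : coreg_alg := coreg_mk COREG0.
Definition coreg_top : coreg_alg := coreg_mk COREG_T.
Definition coreg_le U V : bool := `[< val U `<=` val V >].
Definition coreg_lt U V : bool := (V != U) && coreg_le U V.

Lemma coreg_ext U V : (forall x, val U x <-> val V x) -> U = V.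
Proof. by move=> UV; apply: val_inj; apply/seteqP; split=> x /UV. Qed.

Lemma coreg_le_def U V : coreg_le U V = (coreg_meet U V == U).
Proof.
apply/asboolP/eqP => [UV|<-]; last by move=> x [].
by apply: coreg_ext => x; split=> [[]//|Ux]; split=> //; apply: UV.
Qed.

Lemma coreg_lt_def U V : coreg_lt U V = (V != U) && coreg_le U V.
Proof. by []. Qed.

Lemma coreg_meetC : commutative coreg_meet.
Proof. by move=> U V; apply: coreg_ext => x; split=> -[]. Qed.

Lemma coreg_joinC : commutative coreg_join.
Proof. by move=> U V; apply: val_inj; rewrite /= setUC. Qed.

Lemma coreg_meetA : associative coreg_meet.
Proof. by move=> U V W; apply: val_inj; rewrite /= setIA. Qed.

Lemma coreg_joinP U V x : val (coreg_join U V) x <->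
  forall y, spec_le x y -> exists z, spec_le y z /\ (val U z \/ val V z).
Proof.
by split=> h y xy; have [z] := h y xy; [move=> yz UVz|move=> [yz UVz]];
  exists z.
Qed.

Lemma coreg_upset U x y : spec_le x y -> val U x -> val U y.
Proof. exact: (COREG_upset (coregP U)). Qed.

Lemma coreg_dense U x :
  (forall y, spec_le x y -> exists z, spec_le y z /\ val U z) -> val U x.
Proof.
move=> h; have [_ [_ <-]] := coregP U.
by move=> y /h [z [yz Uz]]; exists z.
Qed.

Lemma coreg_joinA : associative coreg_join.
Proof.
move=> U V W; apply: coreg_ext => x; split=> /coreg_joinP h;
  apply/coreg_joinP => y /h [z [yz]] [].
- move=> Uz; exists z; split=> //; left; apply/coreg_joinP => t zt.
  by exists t; split=> //; left; apply: coreg_upset Uz.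
- move=> /coreg_joinP /(_ z (@spec_le_refl _ z)) [t [zt [Vt|Wt]]].
    exists t; split; first exact: spec_le_trans zt.
    left; apply/coreg_joinP => s ts.
    by exists s; split=> //; right; apply: coreg_upset Vt.
  by exists t; split; [exact: spec_le_trans zt|right].
- move=> /coreg_joinP /(_ z (@spec_le_refl _ z)) [t [zt [Ut|Vt]]].
    by exists t; split; [exact: spec_le_trans zt|left].
  exists t; split; first exact: spec_le_trans zt.
  right; apply/coreg_joinP => s ts.
  by exists s; split=> //; left; apply: coreg_upset Vt.
- move=> Wz; exists z; split=> //; right; apply/coreg_joinP => t zt.
  by exists t; split=> //; right; apply: coreg_upset Wz.
Qed.

Lemma coreg_joinl U V x : val U x -> val (coreg_join U V) x.
Proof.
move=> Ux; apply/coreg_joinP => y xy.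
by exists y; split=> //; left; apply: coreg_upset Ux.
Qed.

Lemma coreg_joinKI V U : coreg_meet U (coreg_join U V) = U.
Proof.
by apply: coreg_ext => x; split=> [[]//|Ux]; split=> //; apply: coreg_joinl.
Qed.

Lemma coreg_meetKU V U : coreg_join U (coreg_meet U V) = U.
Proof.
apply: coreg_ext => x; split; last exact: coreg_joinl.
move=> /coreg_joinP h; apply: coreg_dense => y /h [z [yz Uz]].
by exists z; split=> //; case: Uz => // -[].
Qed.

Lemma coreg_meetUl : left_distributive coreg_meet coreg_join.
Proof.
move=> U V W; apply: coreg_ext => x; split.
  move=> [/coreg_joinP h Wx]; apply/coreg_joinP => y xy.
  have [z [yz UVz]] := h y xy; exists z; split=> //.
  have Wz : val W z by apply: coreg_upset Wx; apply: spec_le_trans yz.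
  by case: UVz => ?; [left|right].
move=> /coreg_joinP h; split.
  apply/coreg_joinP => y /h [z [yz UVz]]; exists z; split=> //.
  by case: UVz => -[]; [left|right].
apply: coreg_dense => y /h [z [yz UVz]]; exists z; split=> //.
by case: UVz => -[].
Qed.

Lemma coreg_meetxx : idempotent_op coreg_meet.
Proof. by move=> U; apply: val_inj; rewrite /= setIid. Qed.

Fact coreg_display : Order.disp_t. Proof. exact: Order.Disp tt tt. Qed.

HB.instance Definition _ :=
  Order.isMeetJoinDistrLattice.Build coreg_display coreg_alg
    coreg_le_def coreg_lt_def coreg_meetC coreg_joinC coreg_meetA coreg_joinA
    coreg_joinKI coreg_meetKU coreg_meetUl coreg_meetxx.

Lemma coreg_le0 U : (coreg_bot <= U)%O.
Proof. by apply/asboolP => x []. Qed.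

Lemma coreg_le1 U : (U <= coreg_top)%O.
Proof. by apply/asboolP => x. Qed.

HB.instance Definition _ :=
  Order.hasBottom.Build coreg_display coreg_alg coreg_le0.
HB.instance Definition _ :=
  Order.hasTop.Build coreg_display coreg_alg coreg_le1.

Lemma coreg_joinxC U : (U `|` coreg_compl U = \top)%O.
Proof.
apply: coreg_ext => x; split=> // _; apply/coreg_joinP => y xy.
have [[z [yz Uz]]|nU] := pselect (exists z, spec_le y z /\ val U z).
  by exists z; split=> //; left.
exists y; split=> //; right => z yz Uz; apply: nU; by exists z.
Qed.

Lemma coreg_meetxC U : (U `&` coreg_compl U = \bot)%O.
Proof.
apply: coreg_ext => x; split=> // -[Ux]; case/(_ x (@spec_le_refl _ x)).
exact: Ux.
Qed.

HB.instance Definition _ :=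
  Order.TBDistrLattice_hasComplement.Build coreg_display coreg_alg
    coreg_joinxC coreg_meetxC.

Lemma coreg_complE U : val (~` U)%O = spec_star (val U).
Proof. by []. Qed.

End CoregAlgebra.

Section G0.
Variables (I : Type) (X : cylindricUV I).
Local Notation B := (coreg_alg X).
Implicit Types (i k l : I) (U V : B).

Definition G0_ex i U : B := coreg_mk (cuv_image i (coregP U)).

Lemma G0_diagP i k : COREG X (cuv_diag i k).
Proof.
split; first exact: cuv_diag_CO.
split; last by rewrite -spec_starK cuv_diagK.
by have [_ /open_upset] := cuv_diag_CO X i k.
Qed.

Definition G0_delta i k : B := coreg_mk (G0_diagP i k).

Lemma G0_exM i U V : (U <= V)%O -> (G0_ex i U <= G0_ex i V)%O.
Proof. by move=> /asboolP UV; apply/asboolP => y [x /UV Vx xy]; exists x. Qed.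

Lemma G0_exK i U : G0_ex i (G0_ex i U) = G0_ex i U.
Proof.
have [_ _ tr] := cuv_equiv X i.
apply: coreg_ext => z; split=> [[y [x Ux xy] yz]|Uz].
  by exists x => //; apply: tr yz.
by exists z => //; have [+ _ _] := cuv_equiv X i; exact.
Qed.

Lemma G0_ex_ge i U : (U <= G0_ex i U)%O.
Proof.
apply/asboolP => x Ux; exists x => //.
by have [+ _ _] := cuv_equiv X i; exact.
Qed.

Lemma G0_exC i U : G0_ex i (~` G0_ex i U)%O = (~` G0_ex i U)%O.
Proof.
have [re sy tr] := cuv_equiv X i.
apply: le_anti; rewrite G0_ex_ge andbT; apply/asboolP => y Vy; rewrite coreg_complE => z yz.
have [v Vv vz] := coreg_upset yz Vy.
rewrite coreg_complE in Vv => -[u Uu uz]; apply: (Vv v (@spec_le_refl _ v)).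
by exists u => //; apply: tr uz _; apply: sy.
Qed.

Lemma G0_exU i U V : G0_ex i (U `|` V)%O = (G0_ex i U `|` G0_ex i V)%O.
Proof.
apply: le_anti; apply/andP; split; last first.
  by rewrite leUx !G0_exM ?leUl ?leUr.
set W : B := (G0_ex i U `|` G0_ex i V)%O.
suff WE : G0_ex i W = W.
  by rewrite -WE; apply/G0_exM/leU2; apply: G0_ex_ge.
have [re sy tr] := cuv_equiv X i.
rewrite -[W]complK complU; set W' : B := (_ `&` _)%O.
suff W'E : G0_ex i W' = W' by rewrite -W'E G0_exC.
apply: le_anti; rewrite G0_ex_ge andbT lexI.
by rewrite -[leRHS]G0_exC -[in X in _ && X]G0_exC !G0_exM ?leIl ?leIr.
Qed.

Lemma G0_quantifier i : is_quantifier (G0_ex i).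
Proof.
split; [exact: G0_exU| |exact: G0_exK|exact: G0_ex_ge|exact: G0_exC].
by apply: coreg_ext => x; split=> // -[].
Qed.

Lemma G0_ex_comm i k U : G0_ex i (G0_ex k U) = G0_ex k (G0_ex i U).
Proof.
have h i' k' z : val (G0_ex i' (G0_ex k' U)) z <->
    exists2 x, val U x & rel_comp (cuv_rel k') (cuv_rel i') x z.
  split=> [[y [x Ux xy] yz]|[x Ux [y xy yz]]].
    by exists x => //; exists y.
  by exists y => //; exists x.
by apply: coreg_ext => x; split=> /h; rewrite cuv_relC => /h.
Qed.

Lemma G0_deltaC i k : G0_delta i k = G0_delta k i.
Proof. by apply: val_inj; rewrite /= cuv_diagC. Qed.

Lemma G0_delta_refl i : G0_delta i i = \top%O.
Proof. by apply: val_inj; rewrite /= cuv_diag_refl. Qed.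

Lemma G0_delta_trans i k l : k <> i -> k <> l ->
  G0_delta i l = G0_ex k (G0_delta i k `&` G0_delta k l)%O.
Proof.
move=> ki kl; apply: val_inj; rewrite /= cuv_diag_trans //.
- by move=> /esym.
- by move=> /esym.
Qed.

Lemma G0_delta_sub i k U : i <> k ->
  (G0_ex i (G0_delta i k `&` U) `&` G0_ex i (G0_delta i k `&` ~` U) = \bot)%O.
Proof.
by move=> ik; apply: val_inj; apply: cuv_diag_sub => //; apply: coregP.
Qed.

Definition G0 : cylindricBA I :=
  CylindricBA G0_quantifier G0_ex_comm G0_deltaC G0_delta_refl
    G0_delta_trans G0_delta_sub.

End G0.

Section FilterSpace.
Context d (A : ctbDistrLatticeType d).
Implicit Types (a b c : A) (F : set A).

Record proper_filter F : Prop := {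
  pf_nonempty : F !=set0;
  pf_meet : forall a b, F a -> F b -> F (a `&` b)%O;
  pf_up : forall a b, F a -> (a <= b)%O -> F b;
  pf_proper : F <> setT }.

Definition filter_space := set_type proper_filter.

HB.instance Definition _ := Choice.on filter_space.

Implicit Types (x y z : filter_space).

Lemma filter_spaceP x : proper_filter (val x).
Proof. exact: set_valP. Qed.

Definition filter_mk F (hF : proper_filter F) : filter_space :=
  exist _ F (mem_set hF).

Definition phi a : set filter_space := [set x | val x a].

Lemma filt_up x a b : val x a -> (a <= b)%O -> val x b.
Proof. exact: (pf_up (filter_spaceP x)). Qed.

Lemma filt_meet x a b : val x (a `&` b)%O <-> val x a /\ val x b.
Proof.
split=> [xab|[]]; last exact: (pf_meet (filter_spaceP x)).
by split; apply: filt_up xab _; rewrite ?leIl ?leIr.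
Qed.

Lemma filt_top x : val x \top%O.
Proof. by have [a xa] := pf_nonempty (filter_spaceP x); apply: filt_up (lex1 a). Qed.

Lemma filt_bot x : ~ val x \bot%O.
Proof.
move=> x0; apply: (pf_proper (filter_spaceP x)).
by apply/seteqP; split=> // a _; apply: filt_up (le0x a).
Qed.

Lemma phiI a b : phi (a `&` b)%O = phi a `&` phi b.
Proof. by apply/seteqP; split=> x /filt_meet. Qed.

Lemma phi_cover : \bigcup_(U in range phi) U = setT.
Proof.
apply/seteqP; split=> // x _; exists (phi \top%O); first by exists \top%O.
exact: filt_top.
Qed.

Lemma phi_join (U V : set filter_space) x :
  range phi U -> range phi V -> U x -> V x ->
  exists W, [/\ range phi W, W x & W `<=` U `&` V].
Proof.
move=> [a _ <-] [b _ <-] xa xb; exists (phi (a `&` b)%O).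
by split; [exists (a `&` b)%O|exact/filt_meet|rewrite phiI].
Qed.

HB.instance Definition _ :=
  @isBaseTopological.Build filter_space (set filter_space) (range phi) id
    phi_cover phi_join.

Lemma phi_open a : open (phi a).
Proof.
exists [set phi a]; first by move=> _ ->; exists a.
by rewrite bigcup_set1.
Qed.

Lemma open_phi (U : set filter_space) x : open U -> U x ->
  exists a, val x a /\ phi a `<=` U.
Proof.
move=> [D DE <-] [V DV Vx]; have [a _ aV] := DE _ DV.
exists a; split; first by rewrite -[val x a]/(phi a x) aV.
by rewrite aV => y Vy; exists V.
Qed.

Lemma spec_leE x y : spec_le x y <-> val x `<=` val y.
Proof.
split=> [xy a xa|xy U oU Ux]; first exact: (xy _ (phi_open a)).
by have [a [/xy ya]] := open_phi oU Ux; apply.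
Qed.

Lemma filter_base (P : set A) : P !=set0 ->
  (forall a b, P a -> P b -> P (a `&` b)%O) -> ~ P \bot%O ->
  proper_filter [set a | exists2 p, P p & (p <= a)%O].
Proof.
move=> [p Pp] PI P0; split.
- by exists p; exists p.
- move=> a b [u Pu ua] [v Pv vb]; exists (u `&` v)%O; first exact: PI.
  exact: leI2.
- by move=> a b [u Pu ua] ab; exists u => //; apply: le_trans ab.
- move=> PT; have [q Pq] : [set a | exists2 p, P p & (p <= a)%O] \bot%O.
    by rewrite PT.
  by rewrite lex0 => /eqP q0; apply: P0; rewrite -q0.
Qed.

Lemma adjoin a x : ~ val x (~` a)%O ->
  exists y, val x `<=` val y /\ val y a.
Proof.
move=> xa; pose P := [set (b `&` a)%O | b in val x].
have hP : proper_filter [set c | exists2 p, P p & (p <= c)%O].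
  apply: filter_base.
  - by exists (\top `&` a)%O; exists \top%O => //; apply: filt_top.
  - move=> _ _ [b xb <-] [c xc <-]; exists (b `&` c)%O; first exact/filt_meet.
    by rewrite meetACA meetxx.
  - move=> [b xb ba0]; apply: xa; apply: filt_up xb _.
    by rewrite -[b]meetx1 -(joinxC a) meetUr ba0 join0x leIr.
exists (filter_mk hP); split.
  by move=> b xb; exists (b `&` a)%O; [exists b|rewrite leIl].
exists (\top `&` a)%O; last by rewrite leIr.
by exists \top%O => //; apply: filt_top.
Qed.

Lemma phi_star a : spec_star (phi a) = phi (~` a)%O.
Proof.
apply/seteqP; split=> x xa.
  apply: contrapT => /adjoin [y [/spec_leE xy ya]]; exact: xa ya.
move=> y /spec_leE xy ya; apply: (@filt_bot y).
by rewrite -(meetxC a); apply/filt_meet; split=> //; apply: xy.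
Qed.

Lemma phi_bot : phi \bot%O = set0.
Proof. by apply/seteqP; split=> // x /filt_bot. Qed.

Lemma phi_top : phi \top%O = setT.
Proof. by apply/seteqP; split=> // x _; apply: filt_top. Qed.

Lemma principal_filter_proper a : a != \bot%O ->
  proper_filter [set b | (a <= b)%O].
Proof.
move=> a0; split.
- by exists a => /=.
- by move=> b c ab ac; rewrite /= lexI; apply/andP.
- by move=> b c ab bc; apply: le_trans bc.
- move=> aT; have : [set b | (a <= b)%O] \bot%O by rewrite aT.
  by rewrite /= lex0 (negbTE a0).
Qed.

Lemma phi_le a b : phi a `<=` phi b -> (a <= b)%O.
Proof.
move=> ab; have [->|a0] := eqVneq a \bot%O; first exact: le0x.
have := ab (filter_mk (principal_filter_proper a0)); apply.
exact: lexx.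
Qed.

Lemma phi_inj : injective phi.
Proof. by move=> a b ab; apply: le_anti; rewrite !phi_le ?ab. Qed.

Lemma phi_compact a : compact (phi a).
Proof.
have [->|a0] := eqVneq a \bot%O; first by rewrite phi_bot; apply: compact0.
move=> F FF Fa; pose p := filter_mk (principal_filter_proper a0).
have pa : phi a p by apply: lexx.
exists p; split=> // B C FB; rewrite nbhsE => -[D [oD Dp] DC].
have aD : phi a `<=` D.
  have [b [pb bD]] := open_phi oD Dp.
  by move=> x xa; apply: bD; apply: filt_up pb.
have [x [Bx xa]] : B `&` phi a !=set0.
  by apply: (@filter_ex _ F); apply: filterI.
by exists x; split=> //; apply: DC; apply: aD.
Qed.

Lemma phi_COREG a : COREG filter_space (phi a).
Proof.
split; first by split; [exact: phi_compact|exact: phi_open].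
split; first by apply: open_upset; apply: phi_open.
by rewrite -spec_starK !phi_star complK.
Qed.

Lemma phi_sub_join (U : set filter_space) a b : REG filter_space U ->
  phi a `<=` U -> phi b `<=` U -> phi (a `|` b)%O `<=` U.
Proof.
move=> [_ UE] aU bU x xab; rewrite -UE => y /spec_leE xy.
have [/adjoin [z [/spec_leE yz za]]|/contrapT ya] := pselect (~ val y (~` a)%O).
  by exists z => //; apply: aU.
exists y; first exact: spec_le_refl.
apply/bU/(@filt_up _ (~` a `&` (a `|` b))%O).
  by apply/filt_meet; split=> //; apply: xy.
by rewrite meetUr meetCx join0x leIr.
Qed.

Lemma COREG_phi (U : set filter_space) :
  COREG filter_space U -> exists a, U = phi a.
Proof.
move=> [[cU oU] rU]; apply: contrapT => nU.
pose D := [set a | phi a `<=` U].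
pose F := filter_from D (fun a => U `\` phi a).
have FF : ProperFilter F.
  apply: filter_from_proper.
    apply: filter_from_filter; first by exists \bot%O; rewrite /D /= phi_bot.
    move=> a b aU bU; exists (a `|` b)%O; first exact: phi_sub_join.
    move=> x [Ux xab]; split; split=> // xa; apply: xab;
      by apply: filt_up xa _; rewrite ?leUl ?leUr.
  move=> a aU; apply/set0P/eqP => Ua0; apply: nU; exists a.
  apply/seteqP; split=> // x Ux; apply: contrapT => xa.
  by have : (U `\` phi a) x by []; rewrite Ua0.
have FU : F U.
  by exists \bot%O; [rewrite /D /= phi_bot|move=> x []].
have [p [Up Fp]] := cU F FF FU.
have [a [pa aU]] := open_phi oU Up.
have [] := Fp (U `\` phi a) (phi a); first by exists a.
  by apply: open_nbhs_nbhs; split=> //; apply: phi_open.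
by move=> x [[]].
Qed.

Lemma filter_space_UV : is_UV filter_space.
Proof.
split.
- move=> x y xy.
  have [[a [xa ya]]|h] := pselect (exists a, val x a /\ ~ val y a).
    exists (phi a); left; split; rewrite inE //.
    by apply: open_nbhs_nbhs; split=> //; apply: phi_open.
  have [[a [ya xa]]|h'] := pselect (exists a, val y a /\ ~ val x a).
    exists (phi a); right; split; rewrite inE //.
    by apply: open_nbhs_nbhs; split=> //; apply: phi_open.
  case/eqP: xy; apply: val_inj; apply/seteqP; split=> a ?; apply: contrapT => ?.
    by apply: h; exists a.
  by apply: h'; exists a.
- move=> U V /COREG_phi [a ->] /COREG_phi [b ->]; rewrite -phiI.
  exact: phi_COREG.
- move=> U /COREG_phi [a ->]; rewrite -/(spec_star _) phi_star.
  exact: phi_COREG.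
- split; first by move=> U /COREG_open.
  move=> x V; rewrite nbhsE => -[U [oU Ux] UV].
  have [a [xa aU]] := open_phi oU Ux; exists (phi a).
    by split=> //; apply: phi_COREG.
  by apply: subset_trans UV.
- move=> F [Fsub [U FU] FI Fup Fpr].
  have hF : proper_filter [set a | F (phi a)].
    split.
    + by have [a Ua] := COREG_phi (Fsub _ FU); exists a; rewrite /= -Ua.
    + by move=> a b Fa Fb; rewrite /= phiI; apply: FI.
    + move=> a b Fa ab; apply: Fup Fa (phi_COREG b) _ => x xa.
      exact: filt_up ab.
    + move=> FT; apply: Fpr; apply/seteqP; split=> // V /COREG_phi [a ->].
      by have : [set a | F (phi a)] a by rewrite FT.
  exists (filter_mk hF); apply/seteqP; split=> V.
    by move=> FV; have hV := Fsub _ FV; split=> //; have [a Va] := COREG_phi hV;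
      move: FV; rewrite Va.
  by move=> [/COREG_phi [a ->]].
Qed.

Definition filter_uv : uvSpace := UVSpace filter_space_UV.

End FilterSpace.

Arguments filter_space {d} A.

Section F0.
Variables (I : Type) (A : cylindricBA I).
Local Notation X := (filter_space A).
Implicit Types (i k l : I) (x y z : X) (a b : A).

Definition F0_rel i x y : Prop := cba_ex i @` val x = cba_ex i @` val y.

Definition F0_diag i k : set X := phi (cba_delta i k).

Lemma ex_ge i a : (a <= cba_ex i a)%O.
Proof. exact: quantifier_ge (cba_quantifier A i) a. Qed.

Lemma exK i a : cba_ex i (cba_ex i a) = cba_ex i a.
Proof. exact: quantifierK (cba_quantifier A i) a. Qed.

Lemma ex0 i : cba_ex i \bot%O = \bot%O :> A.
Proof. exact: quantifier0 (cba_quantifier A i). Qed.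

Lemma exM i a b : (a <= b)%O -> (cba_ex i a <= cba_ex i b)%O.
Proof.
move=> /join_idPr <-; rewrite (quantifierU (cba_quantifier A i)).
exact: leUl.
Qed.

Lemma ex_meet i a b :
  cba_ex i (cba_ex i a `&` b)%O = (cba_ex i a `&` cba_ex i b)%O.
Proof.
have q := cba_quantifier A i; apply: le_anti; apply/andP; split.
  by rewrite lexI -{2}(exK i a) !exM ?leIl ?leIr.
have bE : (b <= (cba_ex i a `&` b) `|` ~` cba_ex i a)%O.
  by rewrite joinIl joinxC meet1x leUl.
apply: le_trans (leI2 (lexx _) (exM i bE)) _.
by rewrite (quantifierU q) (quantifierC q) meetUr meetxC joinx0 leIr.
Qed.

Lemma F0_relP i x y :
  F0_rel i x y <-> forall a, val x (cba_ex i a) <-> val y (cba_ex i a).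
Proof.
have h z a : val z (cba_ex i a) <-> (cba_ex i @` val z) (cba_ex i a).
  split=> [za|[b zb <-]]; first by exists (cba_ex i a); rewrite // exK.
  exact: filt_up (ex_ge i b).
split=> [xy a|xy].
  by split=> /h za; apply/h; [rewrite -[_ @` _]xy|rewrite [_ @` _]xy].
apply/seteqP; split=> _ [a za <-]; apply/h/xy;
  by apply: filt_up za _; apply: ex_ge.
Qed.

Lemma F0_equiv i : RelationClasses.Equivalence (F0_rel i).
Proof.
split; first by [].
  by move=> x y xy; apply: esym.
by move=> x y z; apply: etrans.
Qed.

Lemma F0_relC_sub i k x z : rel_comp (F0_rel i) (F0_rel k) x z ->
  rel_comp (F0_rel k) (F0_rel i) x z.
Proof.
move=> [y /F0_relP xy /F0_relP yz].
pose P := [set u | exists a b,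
  [/\ val x (cba_ex k a), val z (cba_ex i b)
    & u = (cba_ex k a `&` cba_ex i b)%O]].
have exI j a b : (cba_ex j a `&` cba_ex j b)%O = cba_ex j (cba_ex j a `&` b)%O.
  by rewrite ex_meet.
have hx a b : val x (cba_ex k a) -> val z (cba_ex i b) ->
    val x (cba_ex k (cba_ex i b)).
  move=> xa zb; rewrite cba_exC; apply/xy; rewrite cba_exC; apply/yz.
  exact: filt_up zb (ex_ge _ _).
have hz a b : val x (cba_ex k a) -> val z (cba_ex i b) ->
    val z (cba_ex i (cba_ex k a)).
  move=> xa zb; rewrite cba_exC; apply/yz; rewrite cba_exC; apply/xy.
  exact: filt_up xa (ex_ge _ _).
have hP : proper_filter [set c | exists2 p, P p & (p <= c)%O].
  apply: filter_base.
  - exists (cba_ex k \top `&` cba_ex i \top)%O; exists \top%O, \top%O.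
    by split=> //; apply: filt_up (ex_ge _ _); apply: filt_top.
  - move=> _ _ [a [b [xa zb ->]]] [a' [b' [xa' zb' ->]]].
    exists (cba_ex k a `&` a')%O, (cba_ex i b `&` b')%O.
    by rewrite !ex_meet meetACA; split=> //; apply/filt_meet.
  - move=> [a [b [xa zb /esym ab0]]]; apply: (@filt_bot _ _ x).
    rewrite -(ex0 k) -ab0 ex_meet; apply/filt_meet; split=> //.
    exact: hx xa zb.
exists (filter_mk hP); apply/F0_relP => c; split.
- move=> xc; exists (cba_ex k c `&` cba_ex i \top)%O; last exact: leIl.
  exists c, \top%O; split=> //.
  by apply: filt_up (ex_ge _ _); apply: filt_top.
- move=> [_ [a [b [xa zb ->]]]] /(exM k); rewrite exK ex_meet.
  by apply: filt_up; apply/filt_meet; split=> //; apply: hx xa zb.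
- move=> [_ [a [b [xa zb ->]]]] /(exM i); rewrite exK meetC ex_meet.
  by apply: filt_up; apply/filt_meet; split=> //; apply: hz xa zb.
- move=> zc; exists (cba_ex k \top `&` cba_ex i c)%O; last exact: leIr.
  exists \top%O, c; split=> //.
  by apply: filt_up (ex_ge _ _); apply: filt_top.
Qed.

Lemma F0_relC i k :
  rel_comp (F0_rel i) (F0_rel k) = rel_comp (F0_rel k) (F0_rel i).
Proof.
by apply/funext => x; apply/funext => z; apply/propext; split;
  apply: F0_relC_sub.
Qed.

Lemma F0_image i a : rel_image (F0_rel i) (phi a) = phi (cba_ex i a).
Proof.
apply/seteqP; split=> [y [x xa /F0_relP xy]|y ya].
  by apply/xy; apply: filt_up xa (ex_ge _ _).
pose P := [set u | exists2 b,
  val y (cba_ex i b) & u = (cba_ex i b `&` a)%O].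
have hP : proper_filter [set c | exists2 p, P p & (p <= c)%O].
  apply: filter_base.
  - by exists (cba_ex i a `&` a)%O; exists a.
  - move=> _ _ [b yb ->] [c yc ->]; exists (cba_ex i b `&` c)%O.
      by rewrite ex_meet; apply/filt_meet.
    by rewrite ex_meet meetACA meetxx.
  - move=> [b yb /esym ba0]; apply: (@filt_bot _ _ y).
    by rewrite -(ex0 i) -ba0 ex_meet; apply/filt_meet.
exists (filter_mk hP).
  by exists (cba_ex i a `&` a)%O; [exists a|rewrite leIr].
apply/F0_relP => c; split.
- move=> [_ [b yb ->]] /(exM i); rewrite exK ex_meet.
  by apply: filt_up; apply/filt_meet.
- by move=> yc; exists (cba_ex i c `&` a)%O; [exists c|rewrite leIl].
Qed.

Lemma F0_diagK i k : spec_star (spec_star (F0_diag i k)) = F0_diag i k.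
Proof. exact/COREG_regular/phi_COREG. Qed.

Lemma F0_diagC i k : F0_diag i k = F0_diag k i.
Proof. by rewrite /F0_diag cba_deltaC. Qed.

Lemma F0_diag_refl i : F0_diag i i = setT.
Proof. by rewrite /F0_diag cba_delta_refl phi_top. Qed.

Lemma F0_diag_trans i k l : i <> k -> l <> k ->
  rel_image (F0_rel k) (F0_diag i k `&` F0_diag k l) = F0_diag i l.
Proof.
move=> ik lk; rewrite -phiI F0_image -cba_delta_trans //.
- by move=> /esym.
- by move=> /esym.
Qed.

Lemma F0_diag_sub i k : i <> k -> forall U, COREG X U ->
  rel_image (F0_rel i) (F0_diag i k `&` U) `&`
  rel_image (F0_rel i) (F0_diag i k `&` spec_star U) = set0.
Proof.
move=> ik U /COREG_phi [a ->].
by rewrite phi_star -!phiI !F0_image -phiI cba_delta_sub // phi_bot.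
Qed.

Lemma F0_image_COREG i U : COREG X U -> COREG X (rel_image (F0_rel i) U).
Proof. by move=> /COREG_phi [a ->]; rewrite F0_image; apply: phi_COREG. Qed.

Lemma F0_sep i x y : ~ F0_rel i x y ->
  rel_image (F0_rel i) @` COREG_at x <> rel_image (F0_rel i) @` COREG_at y.
Proof.
move=> xy exy; apply: xy.
have h z a : val z (cba_ex i a) <->
    (rel_image (F0_rel i) @` COREG_at z) (phi (cba_ex i a)).
  split=> [za|[_ [/COREG_phi [b ->] zb]]].
    exists (phi (cba_ex i a)); last by rewrite F0_image exK.
    by split=> //; apply: phi_COREG.
  by rewrite F0_image => /phi_inj <-; apply: filt_up zb (ex_ge _ _).
by apply/F0_relP => a; split=> /h za; apply/h; [rewrite -exy|rewrite exy].
Qed.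

Lemma F0_diag_CO i k : CO X (F0_diag i k).
Proof. by have [] := phi_COREG (cba_delta i k : A). Qed.

Definition F0 : cylindricUV I :=
  @CylindricUV I (filter_uv A) F0_rel F0_diag F0_equiv F0_relC F0_diagK
    F0_diagC F0_diag_refl F0_diag_trans F0_diag_sub F0_image_COREG F0_sep
    F0_diag_CO.

End F0.

(* Main.v *)
From mathcomp Require Import all_boot all_order.
From mathcomp Require Import all_classical topology.
Require Import Defs.

Set Implicit Arguments.
Unset Strict Implicit.
Unset Printing Implicit Defensive.

Import Order.Theory.
Local Open Scope classical_set_scope.

(** This is Stone duality for Boolean algebras, in the form whose points are
    arbitrary proper filters instead of ultrafilters, carried over to cylindric
    structure.

    On the algebraic side the isomorphism is [a |-> phi a].  It is injective
    because a non-zero element generates a proper principal filter, and onto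
    the compact regular opens of the filter space by compactness; it turns
    complement into the regular-open pseudocomplement and quantification into
    saturation under the associated equivalence.  Joins require no argument of
    their own: in both algebras they are De Morgan duals of meets.

    On the spatial side the homeomorphism sends a point [x] to the filter of
    compact regular opens containing it.  These sets form a basis, so the T0
    axiom makes the map injective; the filter axiom of UV-spaces makes it
    surjective; and, [U] being the preimage of [phi U], basic opens correspond
    to basic opens in both directions ([point_filter_continuous],
    [point_filter_inv_continuous]).  For the relations,
    membership of [x] in the [S]-saturation of [U] depends only on the [S]-class
    of [x], so related points have filters with the same quantified members; the
    converse is precisely the separation axiom of cylindric UV-spaces, read
    in the algebra of compact regular opens. *)

(** The join of two regular opens is the double pseudocomplement of their union;
    De Morgan makes it unnecessary to compute it. *)
Lemma morph_join_of_meet_compl d d' (A : ctbDistrLatticeType d)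
    (B : ctbDistrLatticeType d') (f : A -> B) :
  {morph f : a b / (a `&` b)%O} -> {morph f : a / (~` a)%O} ->
  {morph f : a b / (a `|` b)%O}.
Proof.
move=> fI fC a b; rewrite -[(a `|` b)%O]complK complU.
by rewrite fC fI !fC complI !complK.
Qed.

Section Algebra.
Variables (I : Type) (A : cylindricBA I).

Definition phi_coreg (a : A) : G0 (F0 A) :=
  @coreg_mk (filter_uv A) (phi a) (phi_COREG a).

Lemma phi_coreg_bij : bijective phi_coreg.
Proof.
have phi_coreg_inj : injective phi_coreg.
  by move=> a b /(congr1 val) /phi_inj.
have surj (U : G0 (F0 A)) : {a | phi_coreg a = U}.
  apply: cid; have [a Ua] := COREG_phi (coregP U).
  by exists a; apply: val_inj; rewrite /= -Ua.
exists (fun U => projT1 (surj U)) => [a|U]; last exact: projT2 (surj U).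
exact/phi_coreg_inj/(projT2 (surj _)).
Qed.

Lemma phi_coregI : {morph phi_coreg : a b / (a `&` b)%O}.
Proof. by move=> a b; apply: val_inj; exact: phiI. Qed.

Lemma phi_coregC : {morph phi_coreg : a / (~` a)%O}.
Proof. by move=> a; apply: val_inj; rewrite coreg_complE /= phi_star. Qed.

Lemma phi_coreg_ex i : {morph phi_coreg : a / cba_ex i a}.
Proof. by move=> a; apply: val_inj; rewrite /= F0_image. Qed.

Lemma cba_isomorphic_G0F0 : cba_isomorphic A (G0 (F0 A)).
Proof.
exists phi_coreg; split; first exact: phi_coreg_bij.
split; first exact: phi_coregI.
split; first exact: morph_join_of_meet_compl phi_coregI phi_coregC.
split; first exact: phi_coregC.
split; first by apply: val_inj; exact: phi_bot.
split; first by apply: val_inj; exact: phi_top.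
split; first exact: phi_coreg_ex.
by move=> i k; exact: val_inj.
Qed.

End Algebra.

Section UV.
Variable X : uvSpace.
Implicit Types (x y : X) (U : coreg_alg X).

Lemma point_filter_proper x : proper_filter [set U : coreg_alg X | val U x].
Proof.
split.
- by exists \top%O.
- by move=> U V.
- by move=> U V Ux /asboolP; exact.
- by move=> xT; have : [set U : coreg_alg X | val U x] \bot%O by rewrite xT.
Qed.

Definition point_filter x : filter_space (coreg_alg X) :=
  filter_mk (point_filter_proper x).

(** Neighbourhoods have to be tested only on compact regular opens, which form
    a basis.  This yields both the T0 separation used for injectivity and the
    continuity of the inverse of [point_filter]. *)
Lemma nbhs_coreg x (V : set X) : nbhs x V ->
  exists U, val U x /\ val U `<=` V.
Proof.
have [_ bX] := uv_basis (uvP X).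
by move=> /bX [U [hU Ux] UV]; exists (coreg_mk hU).
Qed.

Lemma point_filter_inj : injective point_filter.
Proof.
move=> x y xy; apply: contrapT => /eqP /(uv_T0 (uvP X)) [V].
have Uxy U : val U x <-> val U y.
  by rewrite -[val U x]/(val (point_filter x) U) xy.
by case=> -[]; rewrite !inE => /nbhs_coreg [U [/Uxy U1 UV]] []; exact: UV.
Qed.

(** A filter of the algebra of compact regular opens is a proper filter of sets
    as in the filter axiom, up to forgetting the bundled regularity proofs. *)
Lemma point_filter_surj (p : filter_space (coreg_alg X)) :
  exists x, point_filter x = p.
Proof.
pose F : set (set X) := (@set_val _ (COREG X)) @` val p.
have FE U : F (val U) <-> val p U.
  by split=> [[V pV /val_inj <-]|pU] //; exists U.
have hF : coreg_proper_filter F.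
  split.
  - by move=> _ [U _ <-]; exact: coregP.
  - by exists (val (\top%O : coreg_alg X)); apply/FE; exact: filt_top.
  - move=> _ _ [U pU <-] [V pV <-].
    exact/(FE (U `&` V)%O)/filt_meet.
  - move=> _ V [U pU <-] hV UV; apply/(FE (coreg_mk hV)).
    by apply: filt_up pU _; apply/asboolP.
  - move=> FT; have : F (val (\bot%O : coreg_alg X)).
      by rewrite FT; exact: coregP.
    by move=> /FE; exact: filt_bot.
have [x Fx] := uv_filter (uvP X) hF.
exists x; apply: val_inj; apply/seteqP; split=> U.
  by move=> Ux; apply/FE; rewrite Fx; split=> //; exact: coregP.
by move=> /FE; rewrite Fx => -[].
Qed.

(** [val U] is the preimage of the basic open [phi U], so the two neighbourhood
    filters have matching bases. *)
Lemma point_filter_continuous : continuous point_filter.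
Proof.
move=> x V; rewrite nbhsE => -[W [oW Wx] WV].
have [U [xU UW]] := open_phi oW Wx.
rewrite nbhsE; exists (val U); last by move=> y Uy; apply/WV/UW.
by split=> //; exact/COREG_open/coregP.
Qed.

Lemma point_filter_inv_continuous (g : filter_space (coreg_alg X) -> X) :
  cancel g point_filter -> continuous g.
Proof.
move=> gK p V /nbhs_coreg [U [Ugp UV]].
have gE q : val U (g q) <-> val q U.
  by rewrite -[val U (g q)]/(val (point_filter (g q)) U) gK.
rewrite nbhsE; exists (phi U); last by move=> q qU; apply/UV/gE.
by split; [exact: phi_open|exact/gE].
Qed.

End UV.

Section CylindricUV.
Variables (I : Type) (X : cylindricUV I).

(** The separation axiom is stated for sets of points, the relation of the filter
    space for elements of the algebra; this is the translation between them. *)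
Lemma ex_point_filter i (x : X) :
  rel_image (cuv_rel i) @` COREG_at x =
  (@set_val _ (COREG X)) @` (@cba_ex _ (G0 X) i @` val (point_filter x)).
Proof.
apply/seteqP; split=> [_ [U [hU Ux] <-]|_ [_ [U Ux <-] <-]].
  by exists (cba_ex i (coreg_mk hU : G0 X)) => //; exists (coreg_mk hU).
by exists (val U) => //; split=> //; exact: coregP.
Qed.

(** Symmetry and transitivity say that a saturated set does not distinguish
    related points, which gives one direction; the other is the separation
    axiom. *)
Lemma rel_point_filter i (x y : X) :
  cuv_rel i x y <->
  @F0_rel _ (G0 X) i (point_filter x) (point_filter y).
Proof.
have [_ sy tr] := cuv_equiv X i; split=> [xy|exy].
  apply/F0_relP => U; split=> -[u Uu ?]; exists u => //; first exact: tr xy.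
  by apply: tr (sy _ _ xy).
apply: contrapT => nxy; apply: (cuv_sep nxy).
by rewrite !ex_point_filter [X in _ @` X]exy.
Qed.

Lemma relationally_homeomorphic_F0G0 : relationally_homeomorphic X (F0 (G0 X)).
Proof.
have gP (p : F0 (G0 X)) := cid (point_filter_surj p).
have gK : cancel (fun p => projT1 (gP p)) (@point_filter X).
  by move=> p; exact: projT2 (gP p).
exists (@point_filter X), (fun p => projT1 (gP p)).
split; first by move=> x; apply: point_filter_inj; rewrite gK.
split; first exact: gK.
split; first exact: point_filter_continuous.
split; first exact: point_filter_inv_continuous gK.
exact: rel_point_filter.
Qed.

End CylindricUV.

Theorem theorem7p7 (I : Type) :
  (forall A : cylindricBA I, cba_isomorphic A (G0 (F0 A))) /\
  (forall X : cylindricUV I, relationally_homeomorphic X (F0 (G0 X))).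
Proof.
split; first exact: cba_isomorphic_G0F0.
exact: relationally_homeomorphic_F0G0.
Qed.
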